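(* For any convex polygon $P$ and any $k\ge 2$: (1) $k\text{-DIR}\not\subseteq P_{hom}$; (2) $P_{hom}\not\subseteq k\text{-DIR}$.
   Context: All graphs are finite. A polygon is a closed convex polygon in $\mathbb{R}^2$. For a finite collection of sets, its intersection graph has one vertex for each member of the collection, and two distinct vertices are adjacent iff the corresponding sets have nonempty intersection. $P_{hom}$ is the class of intersection graphs of finite collections of sets homothetic to $P$, i.e. sets obtained from $P$ by (positive) scaling and/or translation. $k\text{-DIR}$ is the class of intersection graphs of finite collections of straight-line segments in the plane in which all segments are parallel to at most $k$ directions. *)

(* Defs.v *)
From HB Require Import structures.
From mathcomp Require Import all_boot all_order all_algebra.
From mathcomp Require Import boolp classical_sets functions cardinality.
From mathcomp Require Import set_interval reals convex.

Set Implicit Arguments.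
Unset Strict Implicit.
Unset Printing Implicit Defensive.

Import Order.TTheory GRing.Theory Num.Theory.

Local Open Scope classical_set_scope.
Local Open Scope ring_scope.

Record sgraph := SGraph {
  vertex :> finType;
  adj : rel vertex;
  adj_sym : symmetric adj;
  adj_irr : irreflexive adj }.

(* [set sgraph] would be a universe inconsistency. *)
Definition graph_class := sgraph -> Prop.

Definition subclass (C D : graph_class) := forall G, C G -> D G.

(* The members of the collection are indexed by the vertices: repetitions are
   allowed, and classes of intersection graphs are isomorphism-closed. *)
Definition intersection_graph_of (T : Type) (G : sgraph) (F : G -> set T) :=
  forall u v : G, u != v -> (adj u v <-> F u `&` F v !=set0).

Section Plane.
Variable R : realType.
Local Notation plane := 'rV[R]_2.
Implicit Types (P S : set plane) (a b d : plane).

Definition convex_hull S : set plane := smallest (@convex_set R plane) S.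

Definition line a d : set plane := [set a + t *: d | t in [set: R]].

(* Degenerate hulls (points, segments, the empty set) are excluded. *)
Definition polygon P :=
  (exists V : set plane, finite_set V /\ P = convex_hull V) /\
  ~ (exists a d, P `<=` line a d).

Definition homothetic P S :=
  exists (s : R) (t : plane), 0 < s /\ S = [set s *: x + t | x in P].

Definition Phom P : graph_class := fun G =>
  exists F : G -> set plane,
    (forall v, homothetic P (F v)) /\ intersection_graph_of F.

Definition segment a b : set plane :=
  [set (1 - t) *: a + t *: b | t in `[0, 1]].

Definition segment_parallel_to d S :=
  exists a b, a != b /\ S = segment a b /\ exists c : R, b - a = c *: d.

(* The directions [D i] need not be distinct: at most k of them are used. *)
Definition DIR (k : nat) : graph_class := fun G =>
  exists D : 'I_k -> plane, (forall i, D i != 0) /\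
    exists F : G -> set plane,
      (forall v, exists i, segment_parallel_to (D i) (F v)) /\
      intersection_graph_of F.

End Plane.

(* Main.v *)
(* Complete bipartite graphs K_{n,n} are intersection graphs of horizontal and
   vertical segments. In a representation by homothets of P, the smallest
   member meets n pairwise disjoint members at least as large; shrinking each
   of them about a common point gives n disjoint translates of one copy of P
   at bounded distance, so n is bounded.

   Conversely, consider the clique K_n with one pendant vertex per clique
   vertex. Among the clique vertices of a k-DIR representation with n > 2k,
   three have parallel segments; these pairwise meet, hence lie on one line,
   and the pendants need a point private to each of them, which is impossible
   for three pairwise intersecting intervals. For every P the graph is
   represented by slightly shifted copies of P along a supporting line touching
   P in a single vertex v, with tiny copies of P across that line, each touching
   it at one of the translates of v. *)
Require Import Defs.
From mathcomp Require Import all_boot all_order all_algebra.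
From mathcomp Require Import classical_sets reals.
From mathcomp Require Import boolp cardinality interval_inference.
From mathcomp Require Import convex ring lra.

Set Implicit Arguments.
Unset Strict Implicit.
Unset Printing Implicit Defensive.

Import Order.TTheory GRing.Theory Num.Theory.

Local Open Scope classical_set_scope.

(** * The two families of witness graphs *)

Definition biclique_adj n : rel (bool * 'I_n) := fun u v => u.1 != v.1.

Lemma biclique_sym n : symmetric (@biclique_adj n).
Proof. by move=> u v; rewrite /biclique_adj eq_sym. Qed.

Lemma biclique_irr n : irreflexive (@biclique_adj n).
Proof. by move=> u; rewrite /biclique_adj eqxx. Qed.

Definition biclique n := SGraph (@biclique_sym n) (@biclique_irr n).

(* The corona of K_n: each vertex (i, false) of the clique receives a pendant
   neighbour (i, true). *)
Definition corona_adj n : rel ('I_n * bool) := fun u v =>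
  if u.1 == v.1 then u.2 != v.2 else ~~ u.2 && ~~ v.2.

Lemma corona_sym n : symmetric (@corona_adj n).
Proof. by move=> u v; rewrite /corona_adj eq_sym [v.2 == _]eq_sym andbC. Qed.

Lemma corona_irr n : irreflexive (@corona_adj n).
Proof. by move=> u; rewrite /corona_adj !eqxx. Qed.

Definition corona n := SGraph (@corona_sym n) (@corona_irr n).

Section Plane.
Local Open Scope ring_scope.
Variable R : realType.
Local Notation plane := 'rV[R]_2.
Implicit Types (x y d : plane) (P S V : set plane).

(** * Coordinates and the sum norm on the plane *)

Lemma planeP x y : x 0 0 = y 0 0 -> x 0 1 = y 0 1 -> x = y.
Proof.
move=> e0 e1; apply/rowP => i.
case: (unliftP 0 i) => [j|] -> //.
by rewrite ord1 (_ : lift 0 0 = 1) //; apply: val_inj.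
Qed.

Definition vec2 (a b : R) : plane := \row_i (if i == 0 then a else b).

Lemma vec2_0 a b : vec2 a b 0 0 = a.
Proof. by rewrite mxE. Qed.

Lemma vec2_1 a b : vec2 a b 0 1 = b.
Proof. by rewrite mxE. Qed.

Definition dot x y := x 0 0 * y 0 0 + x 0 1 * y 0 1.

Definition cross x y := x 0 0 * y 0 1 - x 0 1 * y 0 0.

Definition l1 x := `|x 0 0| + `|x 0 1|.

Lemma l1_ge0 x : 0 <= l1 x.
Proof. exact: addr_ge0. Qed.

Lemma l1_gt0 x : x != 0 -> 0 < l1 x.
Proof.
move=> x0; rewrite lt0r l1_ge0 andbT; apply: contra_neq x0 => /eqP.
rewrite /l1 paddr_eq0 // !normr_eq0 => /andP[/eqP e0 /eqP e1].
by apply: planeP; rewrite mxE.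
Qed.

Lemma l1D x y : l1 (x + y) <= l1 x + l1 y.
Proof.
by rewrite /l1 !mxE addrACA lerD // ler_normD.
Qed.

Lemma l1Z c x : l1 (c *: x) = `|c| * l1 x.
Proof. by rewrite /l1 !mxE !normrM mulrDr. Qed.

Lemma l1B x y : l1 (x - y) <= l1 x + l1 y.
Proof. by have := l1D x (- y); rewrite -scaleN1r l1Z normrN1 mul1r. Qed.

Lemma cross_le x y : `|cross x y| <= l1 x * l1 y.
Proof.
rewrite /cross /l1 (le_trans (ler_normB _ _)) // !normrM.
have := @normr_ge0 _ _ (x 0 0); have := @normr_ge0 _ _ (x 0 1).
have := @normr_ge0 _ _ (y 0 0); have := @normr_ge0 _ _ (y 0 1).
by nra.
Qed.

(** * Convex sets and metric properties of polygons *)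

Definition convex S :=
  forall x y (a b : R), 0 <= a -> 0 <= b -> a + b = 1 ->
    S x -> S y -> S (a *: x + b *: y).

(** Trades weights of interval type for two plain reals with sum 1, which suit linear arithmetic. *)
Lemma convexP S : @convex_set R plane S <-> convex S.
Proof.
split=> [cS x y a b a0 b0 ab Sx Sy|cS x y l /set_mem Sx /set_mem Sy].
  have a1 : a <= 1 by lra.
  have /= := cS x y (Itv01 a0 a1) (mem_set Sx) (mem_set Sy).
  move=> /set_mem; rewrite /conv/= /unstable.onem.
  by have -> : 1 - a = b by lra.
apply: mem_set; apply: cS => //=.
- by rewrite subr_ge0.
- by rewrite /unstable.onem addrC subrK.
Qed.

Lemma hull_convex V : convex (convex_hull V).
Proof.
move=> x y a b a0 b0 ab Hx Hy A [cA VA].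
by move/convexP: (cA); apply => //; [apply: Hx | apply: Hy].
Qed.

Lemma hull_sub V S : convex S -> V `<=` S -> convex_hull V `<=` S.
Proof. by move=> cS VS; apply: smallest_sub => //; apply/convexP. Qed.

Lemma polygon_convex P : polygon P -> convex P.
Proof. by move=> [[V [_ ->]] _]; apply: hull_convex. Qed.

Lemma convex_segment (a b : plane) : convex (segment a b).
Proof.
move=> x y s t s0 t0 st [p /=]; rewrite in_itv/= => /andP[p0 p1] <-.
move=> [q /=]; rewrite in_itv/= => /andP[q0 q1] <-.
exists (s * p + t * q) => /=.
  rewrite in_itv/=; apply/andP; split; nra.
have -> : s = 1 - t by lra.
by apply/rowP => i; rewrite !mxE; ring.
Qed.

Lemma finite_argmax V (f : plane -> R) : finite_set V -> V !=set0 ->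
  exists2 v, V v & forall x, V x -> f x <= f v.
Proof.
move=> /finite_seqP[s ->] [x0 /= x0s].
elim: s x0 x0s => // a s IH x0 _.
case: s IH => [_|b s /(_ b (mem_head _ _)) [v vs vmax]].
  by exists a => [|x /=]; rewrite /= inE // => /eqP ->.
have [fav|/ltW fva] := leP (f a) (f v).
  exists v => [|x] /=; rewrite inE; first by rewrite vs orbT.
  by case/orP => [/eqP ->|/vmax].
exists a => [|x] /=; rewrite inE ?eqxx // => /orP[/eqP -> //|/vmax fx].
exact: le_trans fva.
Qed.

Lemma polygon_neq0 P : polygon P -> P !=set0.
Proof.
move=> [_ nP]; apply: contrapT => P0; apply: nP; exists 0, 0 => x Px.
by case: P0; exists x.
Qed.

Lemma hull_neq0 V : convex_hull V !=set0 -> V !=set0.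
Proof.
move=> [x hx]; apply: contrapT => V0.
by apply: (hull_sub (S := set0) _ _ hx) => // y Vy; apply: V0; exists y.
Qed.

(** A ball of the sum norm is convex, so it contains the hull as soon as it contains the
    generators. *)
Lemma polygon_bounded P : polygon P ->
  exists2 M : R, 0 < M & forall x, P x -> l1 x <= M.
Proof.
move=> pP; have P0 := polygon_neq0 pP; case: pP => -[V [fV PE]] _.
move: P0; rewrite PE => /hull_neq0 V0.
have [v _ vmax] := finite_argmax l1 fV V0.
exists (l1 v + 1) => [|x Px]; first by rewrite ltr_wpDl ?l1_ge0.
have /= xv : [set x | l1 x <= l1 v] x; last by rewrite (le_trans xv) ?lerDl.
apply: (hull_sub _ _ Px) => {x Px} // x y a b a0 b0 ab /= xv yv.
rewrite (le_trans (l1D _ _)) // !l1Z !ger0_norm //.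
by rewrite -[leRHS]mul1r -ab mulrDl lerD // ler_wpM2l.
Qed.

(* Three noncollinear points of P span a triangle whose difference body
   contains a neighbourhood of the origin. *)
Lemma polygon_diff P : polygon P -> exists2 h : R, 0 < h &
  forall x, l1 x < h -> exists y z, [/\ P y, P z & y - z = x].
Proof.
move=> pP; have cP := polygon_convex pP; have [p0 Pp0] := polygon_neq0 pP.
case: pP => _ nP.
have [u Pp1 u0] : exists2 u, P (p0 + u) & u != 0.
  apply: contrapT => H; apply: nP; exists p0, 0 => x Px.
  exists 0 => //; rewrite scaler0 addr0; apply: contrapT => /eqP xp.
  by apply: H; exists (x - p0); rewrite ?subr_eq0 1?eq_sym // addrC subrK.
have [v Pp2 D0] : exists2 v, P (p0 + v) & cross u v != 0.
  apply: contrapT => H; apply: nP; exists p0, u => x Px.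
  have [w xE] : exists w, x = p0 + w by exists (x - p0); rewrite addrC subrK.
  have {H} c0 : cross u w = 0.
    by apply: contrapT => /eqP c0; apply: H; exists w => //; rewrite -xE.
  have uu : dot u u != 0.
    apply: contra_neq u0 => /eqP; rewrite /dot -!expr2 paddr_eq0 ?sqr_ge0 //.
    rewrite !sqrf_eq0 => /andP[/eqP e0 /eqP e1].
    by apply: planeP; rewrite mxE.
  (* The coefficient of the orthogonal projection of [w] onto [u]. *)
  exists (dot u w / dot u u) => //; rewrite xE.
  congr (_ + _); apply: planeP; rewrite mxE; apply: (mulIf uu);
    rewrite mulrAC divfK //; move/eqP: c0; rewrite /cross subr_eq0 => /eqP c0;
    rewrite /dot.
  - by have := congr1 ( *%R (u 0 1)) c0; lra.
  - by have := congr1 ( *%R (u 0 0)) c0; lra.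
set D := cross u v in D0.
have lu := l1_gt0 u0; have lv := l1_ge0 v.
have D1 : 0 < `|D| by rewrite normr_gt0.
have luv : 0 < l1 u + l1 v by lra.
exists (`|D| / (l1 u + l1 v)) => [|x xh]; first exact: divr_gt0.
(* Cramer's rule for [x] in the basis [u], [v]; the bound on [l1 x] makes the coefficients small. *)
pose a := cross x v / D; pose b := cross u x / D.
have xE : x = a *: u + b *: v.
  by apply: planeP; rewrite !mxE /a /b; move: D0; rewrite /D /cross => D0; field.
have ab : `|a| + `|b| <= 1.
  rewrite /a /b !normf_div -mulrDl ler_pdivrMr // mul1r.
  have := cross_le x v; have := cross_le u x.
  by move: xh; rewrite ltr_pdivlMr // mulrDr; lra.
have triangle s t : 0 <= s -> 0 <= t -> s + t <= 1 -> P (p0 + s *: u + t *: v).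
  move=> s0 t0 st; have [s1|s1] := eqVneq s 1.
    have -> : t = 0 by lra.
    by rewrite s1 scale0r addr0 scale1r.
  have s2 : 0 < 1 - s by rewrite subr_gt0 lt_neqAle s1 /=; lra.
  have t1 : t / (1 - s) <= 1 by rewrite ler_pdivrMr // mul1r; lra.
  (* Two binary combinations: first a point between [p0] and [p0 + v], then one between it and
     [p0 + u]. *)
  have := cP (p0 + u) _ s (1 - s) s0 (ltW s2) _ Pp1
    (cP p0 _ (1 - t / (1 - s)) (t / (1 - s)) _ _ _ Pp0 Pp2).
  rewrite subr_ge0 t1 divr_ge0 ?(ltW s2) // subrK.
  have -> : s + (1 - s) = 1 by ring.
  move=> /(_ erefl isT isT erefl).
  set y := (X in P X -> _); suff -> : y = p0 + s *: u + t *: v by [].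
  rewrite /y; have s3 : 1 - s != 0 by rewrite gt_eqF.
  by apply/rowP => i; rewrite !mxE; field.
(* Positive and negative parts: the positive parts of [a], [b] give one point of the triangle, the
   negative parts the other. *)
have pm c : exists s t : R, [/\ 0 <= s, 0 <= t, s - t = c & s + t = `|c|].
  by have [c0|c0] := ger0P c; [exists c, 0 | exists 0, (- c)]; split; lra.
have [s [s' [s0 s'0 ss s1]]] := pm a; have [t [t' [t0 t'0 tt t1]]] := pm b.
exists (p0 + s *: u + t *: v), (p0 + s' *: u + t' *: v); split.
- by apply: triangle => //; lra.
- by apply: triangle => //; lra.
- by rewrite xE -ss -tt; apply/rowP => i; rewrite !mxE; ring.
Qed.

(** A generator [v] of largest Euclidean norm is exposed by the functional [dot v]: expanding the
    square of [x - v] shows that a generator [x] reaching the value [dot v v] equals [v]. The point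
    [w], lowest for this functional, later serves as the contact point of the small copies. *)
Lemma polygon_exposed P : polygon P -> exists v w e d : plane,
  [/\ P v, P w, d != 0, dot e d = 0 &
    forall x, P x -> dot e w <= dot e x <= dot e v /\
      (dot e x = dot e v -> x = v)].
Proof.
move=> pP; have P0 := polygon_neq0 pP; case: pP => -[V [fV PE]] nP.
have V0 : V !=set0 by apply: hull_neq0; rewrite -PE.
have [v Vv vmax] := finite_argmax (fun x => dot x x) fV V0.
have [w Vw wmin] := finite_argmax (fun x => - dot v x) fV V0.
have VP : V `<=` P by rewrite PE => x Vx A [_]; apply.
have exv x : V x -> dot v x < dot v v \/ x = v.
  move=> /vmax xv; have [xy|vx] := ltP (dot v x) (dot v v); [by left | right].
  have e : dot (x - v) (x - v) = dot x x - 2 * dot v x + dot v v.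
    by rewrite /dot !mxE; ring.
  have : dot (x - v) (x - v) == 0.
    rewrite eq_le {1}e; apply/andP; split; first by lra.
    by rewrite /dot -!expr2 addr_ge0 ?sqr_ge0.
  rewrite /dot -!expr2 paddr_eq0 ?sqr_ge0 // !sqrf_eq0 !mxE !subr_eq0.
  by move=> /andP[/eqP e0 /eqP e1]; apply: planeP.
have lin x y a b : dot v (a *: x + b *: y) = a * dot v x + b * dot v y.
  by rewrite /dot !mxE; ring.
exists v, w, v, (vec2 (- v 0 1) (v 0 0)); split; [exact: VP|exact: VP| | |].
(* If [v] were 0, every generator would be 0 and P a single point. *)
- apply/eqP => vd; apply: nP; exists v, 0 => x Px.
  exists 0 => //; rewrite scaler0 addr0.
  have [v0 v1] : v 0 0 = 0 /\ v 0 1 = 0.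
    move/rowP: vd => vd; have := vd 1; have := vd 0.
    by rewrite vec2_0 vec2_1 !mxE => /eqP; rewrite oppr_eq0 => /eqP.
  have vx y : dot v y = 0 by rewrite /dot v0 v1; ring.
  apply/esym; move: Px; rewrite PE; apply: (@hull_sub _ [set v]).
    move=> ? ? a b _ _ ab /= -> ->.
    by rewrite -scalerDl ab scale1r.
  by move=> y /exv[|//]; rewrite !vx ltxx.
- by rewrite /dot vec2_0 vec2_1; ring.
- move=> x Px.
  suff [wx [xv|->]] : dot v w <= dot v x /\ (dot v x < dot v v \/ x = v).
  + by split=> [|xE]; [rewrite wx ltW | rewrite xE ltxx in xv].
  + by split=> //; rewrite lexx -lerN2 wmin.
  move: Px; rewrite PE.
  (* An open half-plane together with the boundary point [v], cut by a closed half-plane, is convex;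
     so uniqueness of the maximum passes from the generators to the hull. *)
  pose S : set plane :=
    [set x | dot v w <= dot v x /\ (dot v x < dot v v \/ x = v)].
  apply: (@hull_sub _ S); last first.
    by move=> y Vy; split; [rewrite -lerN2 wmin | exact: exv].
  move=> y z a b a0 b0 ab /=.
  have mean t : t = a * t + b * t by rewrite -mulrDl ab mul1r.
  move=> [wy yv] [wz zv]; split.
    by rewrite lin [leLHS]mean lerD // ler_wpM2l.
  have [aE|a1] := eqVneq a 0.
    by move: ab; rewrite aE add0r => ->; rewrite scale0r add0r scale1r.
  have [bE|b1] := eqVneq b 0.
    by move: ab; rewrite bE addr0 => ->; rewrite scale0r addr0 scale1r.
  have {a0 a1} a0 : 0 < a by rewrite lt0r a1.
  have {b0 b1} b0 : 0 < b by rewrite lt0r b1.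
  case: yv zv => [yv|->] [zv|->]; [left..|right].
  - by rewrite lin [ltRHS]mean ltrD // ltr_pM2l.
  - by rewrite lin [ltRHS]mean ltrD2r ltr_pM2l.
  - by rewrite lin [ltRHS]mean ltrD2l ltr_pM2l.
  - by rewrite -scalerDl ab scale1r.
Qed.

(* Pigeonhole on a square grid of mesh h / 2. *)
Lemma bounded_close_pair (M h : R) : 0 < h -> exists n, forall c : 'I_n.+1 -> plane,
  (forall i, l1 (c i) <= M) -> exists i j, i != j /\ l1 (c i - c j) < h.
Proof.
(* A side of length 2M holds 4M/h cells of width h/2; the successor accounts for the far edge. There
   is one more point than the [K * K] cells. *)
move=> h0; pose K := (Num.truncn (4 * M / h)).+1.
exists (K * K)%N => c cM.
pose cell (a : R) := Num.truncn (2 * (a + M) / h).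
have cellP a : - M <= a -> (cell a)%:R <= 2 * (a + M) / h < (cell a).+1%:R.
  by move=> aM; apply: truncn_itv; apply: divr_ge0; lra.
have cellK a : - M <= a <= M -> (cell a < K)%N.
  move=> /andP[aM Ma]; rewrite ltnS; apply: le_truncn.
  by rewrite ler_pM2r ?invr_gt0 //; lra.
have cellE a b : - M <= a -> - M <= b -> cell a = cell b -> `|a - b| < h / 2.
  move=> /cellP + /cellP + ab; rewrite ab -[(cell b).+1%:R]natr1.
  set q : R := (cell b)%:R; rewrite !ler_pdivlMr // !ltr_pdivrMr //.
  move=> /andP[a1 a2] /andP[b1 b2]; rewrite ltr_norml; apply/andP; split; lra.
have cB i : (- M <= c i 0 0 <= M) /\ (- M <= c i 0 1 <= M).
  rewrite -!ler_norml; move: (cM i); rewrite /l1.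
  have := @normr_ge0 _ _ (c i 0 0); have := @normr_ge0 _ _ (c i 0 1).
  by move=> ? ? ?; split; lra.
pose f i : 'I_K * 'I_K :=
  (Ordinal (cellK _ (cB i).1), Ordinal (cellK _ (cB i).2)).
have [i [j [ij fij]]] : exists i j, i != j /\ f i = f j.
  apply: contrapT => H; have finj : injective f.
    move=> i j fij; apply: contrapT => /eqP ij; apply: H; by exists i, j.
  have := leq_card _ finj.
  by rewrite card_prod !card_ord ltnn.
exists i, j; split => //.
have /andP[i0 _] := (cB i).1; have /andP[i1 _] := (cB i).2.
have /andP[j0 _] := (cB j).1; have /andP[j1 _] := (cB j).2.
have := cellE _ _ i0 j0 (congr1 (fun p => val p.1) fij).
have := cellE _ _ i1 j1 (congr1 (fun p => val p.2) fij).
rewrite /l1 !mxE; lra.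
Qed.

(** * Large bicliques are not represented by homothets of P *)

Lemma Phom_bounded_bipartite P : polygon P -> exists n, ~ Phom P (biclique n.+1).
Proof.
move=> pP; have cP := polygon_convex pP.
have [M M0 PM] := polygon_bounded pP.
have [h h0 Ph] := polygon_diff pP.
have [n close] := bounded_close_pair (M + M) h0.
exists n => -[F [homF intF]].
have /choice[s sP] := homF; have /choice[t {sP}] := sP.
move=> /all_and2[s0 FE].
have [v0 /= smin] : exists v0, forall v, s v0 <= s v.
  case: (@arg_minP _ R _ (false, ord0) xpredT s) => // v0 _ vmin.
  by exists v0 => v; apply: vmin.
pose nb (j : 'I_n.+1) : biclique n.+1 := (~~ v0.1, j).
have meet j : F v0 `&` F (nb j) !=set0.
  apply/intF; last by rewrite /= /biclique_adj /=; case: v0.1.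
  by apply/eqP => /(congr1 fst); rewrite /=; case: v0.1.
(* The common point is the image of [q] in the smallest member and of [p] in the neighbour.
   Shrinking the neighbour about it by the ratio of the scales keeps it inside itself by convexity
   and yields the smallest member translated by [s v0 *: (q - p)]. *)
have /choice[c cP'] : forall j, exists c : plane, l1 c <= M + M /\
    forall y, P y -> F (nb j) (s v0 *: (y + c) + t v0).
  move=> j; have [x []] := meet j; rewrite !FE => -[q Pq qx] [p Pp px].
  exists (q - p); split.
    by rewrite (le_trans (l1B _ _)) // lerD // PM.
  move=> y Py; have sj := s0 (nb j).
  pose r := s v0 / s (nb j).
  have r0 : 0 <= r by apply: divr_ge0; apply: ltW.
  have r1 : r <= 1 by rewrite ler_pdivrMr // mul1r.
  exists (r *: y + (1 - r) *: p).
    by apply: cP => //; [rewrite subr_ge0 | rewrite addrC subrK].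
  have -> : t v0 = s (nb j) *: p + t (nb j) - s v0 *: q.
    by rewrite px -qx addrAC subrr add0r.
  have -> : s v0 = r * s (nb j) by rewrite divfK // gt_eqF.
  by apply/rowP => i; rewrite !mxE; ring.
(* The close offsets satisfy [c i - c j = y - z], so [z + c i = y + c j] lies in both translates,
   and two members on the same side meet. *)
have [i [j [ij /Ph[y [z [Py Pz yz]]]]]] := close c (fun j => (cP' j).1).
have : adj (nb i) (nb j).
  apply/intF; first by apply: contra ij => /eqP[->].
  exists (s v0 *: (z + c i) + t v0); split; first exact: (cP' i).2.
  have -> : z + c i = y + c j; last exact: (cP' j).2.
  have -> : c i = y - z + c j by rewrite yz subrK.
  by rewrite addrA [z + _]addrC subrK.
by rewrite /= /biclique_adj /= eqxx.
Qed.

(** * Bicliques as grids of horizontal and vertical segments *)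

Lemma DIR_biclique k n : (2 <= k)%N -> DIR R k (biclique n.+1).
Proof.
move=> k2; have [N N0 leN] : exists2 N : R, 0 < N & forall a : 'I_n.+1, a%:R <= N.
  by exists n.+1%:R => [|a]; rewrite ?ltr0Sn // ler_nat ltnW.
pose i0 : 'I_k := Ordinal (ltnW k2); pose i1 : 'I_k := Ordinal k2.
exists (fun i => if i == i0 then vec2 1 0 else vec2 0 1); split.
  move=> i; apply/eqP => /rowP E; have := E 0; have := E 1.
  by case: ifP => _; rewrite vec2_0 vec2_1 !mxE => /eqP + /eqP; rewrite oner_eq0.
pose F (v : biclique n.+1) : set plane := let a : R := v.2%:R in
  if v.1 then segment (vec2 a 0) (vec2 a N) else segment (vec2 0 a) (vec2 N a).
have FP v x : F v x <-> if v.1 then x 0 0 = v.2%:R /\ 0 <= x 0 1 <= N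
                        else x 0 1 = v.2%:R /\ 0 <= x 0 0 <= N.
  rewrite /F; case: v => -[] a /=; (split=> [[t /=]|[xa /andP[x0 xN]]]).
  - rewrite in_itv /= => /andP[t0 t1] <-; rewrite !mxE /=; split; first by ring.
    by apply/andP; split; nra.
  - exists (x 0 1 / N).
      by rewrite /= in_itv /= divr_ge0 ?(ltW N0) //= ler_pdivrMr // mul1r.
    by apply: planeP; rewrite !mxE /= ?xa; field; rewrite gt_eqF.
  - rewrite in_itv /= => /andP[t0 t1] <-; rewrite !mxE /=; split; first by ring.
    by apply/andP; split; nra.
  - exists (x 0 0 / N).
      by rewrite /= in_itv /= divr_ge0 ?(ltW N0) //= ler_pdivrMr // mul1r.
    by apply: planeP; rewrite !mxE /= ?xa; field; rewrite gt_eqF.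
exists F; split.
  move=> [b a]; exists (if b then i1 else i0).
  have Nz : N != 0 by rewrite gt_eqF.
  case: b; rewrite /F /=; [exists (vec2 a%:R 0), (vec2 a%:R N)
                          |exists (vec2 0 a%:R), (vec2 N a%:R)]; split.
  - apply: contra Nz => /eqP/rowP/(_ 1); by rewrite !mxE /= => /esym/eqP.
  - by split=> //; exists N; apply: planeP; rewrite !mxE /=; ring.
  - apply: contra Nz => /eqP/rowP/(_ 0); by rewrite !mxE /= => /esym/eqP.
  - by split=> //; exists N; apply: planeP; rewrite !mxE /=; ring.
have rng (a : 'I_n.+1) : 0 <= (a%:R : R) <= N.
  by rewrite ler0n leN.
move=> [b a] [b' a'] uv; rewrite /= /biclique_adj /=; split=> [bb'|].
  case: b b' bb' uv => -[] //= _ _; [exists (vec2 a%:R a'%:R)|exists (vec2 a'%:R a%:R)].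
    by split; apply/FP; rewrite /= !mxE /=; split.
  by split; apply/FP; rewrite /= !mxE /=; split.
move=> [x [/FP + /FP]]; case: b b' uv => -[] //= uv [xa _] [xa' _];
  by move: uv; rewrite xpair_eqE /= -(inj_eq val_inj) -(eqr_nat R) -xa -xa' eqxx.
Qed.

(** * Large coronas are not represented by segments in k directions *)

Lemma collinear_between S o d (a b c : R) : convex S ->
  a <= b -> b <= c -> S (o + a *: d) -> S (o + c *: d) -> S (o + b *: d).
Proof.
move=> cS ab bc Sa Sc; have [ac|ac] := eqVneq a c.
  by have -> : b = a by lra.
have ca : 0 < c - a by rewrite subr_gt0 lt_neqAle ac; lra.
have ca0 : c - a != 0 by rewrite gt_eqF.
have := cS _ _ ((c - b) / (c - a)) ((b - a) / (c - a)) _ _ _ Sa Sc.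
rewrite !divr_ge0 ?subr_ge0 ?(ltW ca) ?(le_trans ab bc) // -mulrDl addrA subrK divff //.
move=> /(_ isT isT erefl).
set y := (X in S X -> _); suff -> : y = o + b *: d by [].
by rewrite /y; apply/rowP => i; rewrite !mxE; field.
Qed.

(** The parameter [b] lies either between [a] and the shared [e], hence in S, or between [e] and
    [c], hence in T. *)
Lemma middle_covered S T o d (a b c : R) : convex S -> convex T ->
  (exists e : R, S (o + e *: d) /\ T (o + e *: d)) -> a <= b -> b <= c ->
  S (o + a *: d) -> T (o + c *: d) -> S (o + b *: d) \/ T (o + b *: d).
Proof.
move=> cS cT [e [Se Te]] ab bc Sa Tc.
have [be|/ltW eb] := leP b e; [left|right].
  exact: collinear_between Sa Se.
exact: collinear_between Te Tc.
Qed.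

Lemma segment_parallel_convex d S : segment_parallel_to d S -> convex S.
Proof. by move=> [a [b [_ [-> _]]]]; apply: convex_segment. Qed.

Lemma segment_parallel_line d S x y : segment_parallel_to d S ->
  S x -> S y -> exists t : R, y = x + t *: d.
Proof.
move=> [a [b [_ [-> [c bac]]]]] [p _ <-] [q _ <-]; exists ((q - p) * c).
have -> : b = a + c *: d by rewrite -bac addrC subrK.
by apply/rowP => i; rewrite !mxE; ring.
Qed.

(* On a common line, the middle one of the three private points lies in the
   union of the two other segments. *)
Lemma no_three_private d (S : 'I_3 -> set plane) (x : 'I_3 -> plane) :
  (forall i, segment_parallel_to d (S i)) ->
  (forall i j, S i `&` S j !=set0) ->
  ~ (forall i j, S j (x i) <-> i = j).
Proof.
move=> Sd SS Sx; have cS i := segment_parallel_convex (Sd i).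
have Sxx i : S i (x i) by apply/Sx.
(* Every member meets [S 0], so parallelism puts all of them on the line of [S 0]. *)
have line i y : S i y -> exists t : R, y = x 0 + t *: d.
  move=> Sy; have [p [S0p Sip]] := SS 0 i.
  have [a pE] := segment_parallel_line (Sd 0) (Sxx 0) S0p.
  have [b ->] := segment_parallel_line (Sd i) Sip Sy.
  by exists (a + b); rewrite pE scalerDl addrA.
have /choice[t tE] i : exists t : R, x i = x 0 + t *: d by exact: line (Sxx i).
have nomid i j k : i != j -> j != k -> t i <= t j -> t j <= t k -> False.
  move=> ij jk tij tjk; have [p [Sip Skp]] := SS i k.
  have [e pE] := line i p Sip; rewrite pE in Sip Skp.
  have Si := Sxx i; have Sk := Sxx k; rewrite tE in Si; rewrite tE in Sk.
  have := @middle_covered _ _ _ _ _ _ _ (cS i) (cS k)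
    (ex_intro _ e (conj Sip Skp)) tij tjk Si Sk.
  rewrite -tE => -[|] /Sx E; first by rewrite E eqxx in ij.
  by rewrite E eqxx in jk.
pose o2 : 'I_3 := lift 0 1.
have [t01|/ltW t01] := leP (t 0) (t 1); have [t12|/ltW t12] := leP (t 1) (t o2);
  have [t02|/ltW t02] := leP (t 0) (t o2).
- exact: (nomid 0 1 o2).
- exact: (nomid 0 1 o2).
- exact: (nomid 0 o2 1).
- exact: (nomid o2 0 1).
- exact: (nomid 1 0 o2).
- exact: (nomid 1 o2 0).
- exact: (nomid o2 1 0).
- exact: (nomid o2 1 0).
Qed.

Lemma not_DIR_corona k : ~ DIR R k (corona (2 * k).+1).
Proof.
move=> [D [_ [F [/choice[col colP] intF]]]]; set n := (2 * k).+1 in F col colP intF.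
(* Otherwise each of the k directions serves at most two clique vertices, giving at most 2k of
   them. *)
have [c c3] : exists c, (2 < #|[pred i : 'I_n | col (i, false) == c]|)%N.
  apply: contrapT => H; have : (n <= 2 * k)%N; last by rewrite ltnn.
  rewrite -[n]card_ord -sum1_card (partition_big (fun i => col (i, false)) xpredT) //=.
  rewrite -[X in (_ <= 2 * X)%N]card_ord mulnC -sum_nat_const; apply: leq_sum => c _.
  rewrite sum1_card leqNgt; apply/negP => c3; apply: H; exists c.
  exact: c3.
move/card_gt2P: c3 => [i [j [l [[]]]]].
rewrite !inE => /eqP ci /eqP cj /eqP cl [ij jl li].
pose g (m : 'I_3) := tnth [tuple i; j; l] m.
have gcol m : col (g m, false) = c.
  by case: m => -[|[|[|//]]] ?; rewrite /g (tnth_nth i).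
have ginj : injective g.
  by apply/tuple_uniqP; rewrite /= !inE negb_or ij jl eq_sym li.
have pend m : F (g m, true) `&` F (g m, false) !=set0.
  by apply/intF; [rewrite xpair_eqE andbF | rewrite /= /corona_adj /= eqxx].
have core m m' : F (g m, false) `&` F (g m', false) !=set0.
  have [<-|mm'] := eqVneq m m'.
    by have [x [_ Sx]] := pend m; exists x.
  apply/intF; first by rewrite xpair_eqE eqxx andbT (inj_eq ginj).
  by rewrite /= /corona_adj /= (inj_eq ginj) (negPf mm').
have /choice[x xP] m : exists x, (F (g m, true) `&` F (g m, false)) x.
  exact: pend.
apply: (@no_three_private (D c) (fun m => F (g m, false)) x) => //.
  by move=> m; have := colP (g m, false); rewrite gcol.
move=> m m'; split=> [xm|<-]; last exact: (xP m).2.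
(* The chosen point lies in the pendant of [g m], which misses every other clique member; hence it
   is private. *)
apply: contrapT => /eqP mm'.
have /intF : F (g m, true) `&` F (g m', false) !=set0.
  by exists (x m); split=> //; exact: (xP m).1.
by rewrite /= /corona_adj /= (inj_eq ginj) (negPf mm') xpair_eqE andbF => /(_ isT).
Qed.

(** * Coronas are represented by homothets of every polygon *)

Lemma Phom_corona P n : polygon P -> Phom P (corona n.+1).
Proof.
move=> pP.
have [M M0 PM] := polygon_bounded pP.
have [h h0 Ph] := polygon_diff pP.
have [v [w [e [d0 [Pv Pw d00 ed0 eP]]]]] := polygon_exposed pP.
have l0 := l1_gt0 d00.
pose N : R := n.+1%:R.
have N0 : 0 < N by rewrite ltr0Sn.
(* Index differences stay below N, so all relative shifts of the large copies are shorter than h and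
   these copies pairwise meet. *)
have [d [ld ed]] : exists d, N * l1 d = h /\ dot e d = 0.
  exists ((h / (N * l1 d0)) *: d0); split.
    rewrite l1Z gtr0_norm; last by rewrite divr_gt0 // mulr_gt0.
    by field; rewrite !gt_eqF.
  by rewrite -[RHS](mulr0 (h / (N * l1 d0))) -ed0 /dot !mxE; ring.
have ld0 : 0 < l1 d by rewrite -(pmulr_rgt0 _ N0) ld.
(* Small copies get diameter below one shift [l1 d], hence are pairwise disjoint. *)
have [r r0 rM] : exists2 r : R, 0 < r & r * (M + M) < l1 d.
  exists (l1 d / (4 * M)); first by rewrite divr_gt0 // mulr_gt0.
  have -> : l1 d / (4 * M) * (M + M) = l1 d / 2 by field; rewrite gt_eqF.
  lra.
have apart (i j : 'I_n.+1) y z : P y -> P z ->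
    r *: y + i%:R *: d = r *: z + j%:R *: d -> i = j.
  move=> Py Pz E; apply: contrapT => /eqP ij.
  have : (i%:R - j%:R) *: d = r *: (z - y).
    by apply/rowP => m; have /= := congr1 (fun x : plane => x 0 m) E;
      rewrite !mxE; lra.
  move=> /(congr1 l1); rewrite !l1Z (ger0_norm (ltW r0)) => {}E.
  have : r * l1 (z - y) <= r * (M + M).
    by rewrite ler_wpM2l ?(ltW r0) // (le_trans (l1B _ _)) // lerD // PM.
  rewrite -E; apply/negP; rewrite -ltNge; apply: lt_le_trans rM _.
  have : 1 <= `|i%:R - j%:R : R|.
    move: ij; rewrite -(inj_eq val_inj) neq_ltn.
    have far (p q : nat) : (p < q)%N -> 1 <= `|q%:R - p%:R : R|.
      by rewrite -(ler_nat R) -natr1 => pq; apply: le_trans (ler_norm _); lra.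
    by case/orP => /far //; rewrite distrC.
  by move=> ij1; rewrite ler_peMl ?l1_ge0.
(* The translation of a small copy sends its lowest point, the image of [w], to [v + i d] on the
   supporting line. *)
pose F (u : corona n.+1) : set plane := if u.2
  then [set r *: x + (v + u.1%:R *: d - r *: w) | x in P]
  else [set 1 *: x + u.1%:R *: d | x in P].
exists F; split.
  move=> [i []]; [exists r, (v + i%:R *: d - r *: w)|exists 1, (i%:R *: d)];
    by split; rewrite ?ltr01.
(* Along [e], small copies lie at or above the level of [v] and large ones at or below it. A common
   point is thus on the supporting line, where exposedness makes it [v + j d]; [apart], applied with
   [w] as second point, then gives equal indices. *)
have cross_disjoint (i j : 'I_n.+1) : F (i, true) `&` F (j, false) !=set0 -> i = j.
  move=> [x [[y Py <-] [z Pz /= zx]]].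
  have zy : dot e z = dot e v + r * (dot e y - dot e w).
    have -> : z = r *: y + (v + i%:R *: d - r *: w) - j%:R *: d.
      by rewrite -zx scale1r addrK.
    rewrite -[RHS]addr0 -(mulr0 (i%:R - j%:R)) -ed /dot !mxE; ring.
  have zv : z = v.
    have [/andP[wy _] _] := eP y Py; have [/andP[_ zv] zvE] := eP z Pz.
    by apply: zvE; apply: le_anti; rewrite zv zy lerDl mulr_ge0 ?(ltW r0) ?subr_ge0.
  apply: (apart i j y w) => //; move: zx; rewrite zv scale1r => E.
  by apply/rowP => m; have /= := congr1 (fun x : plane => x 0 m) E;
    rewrite !mxE; lra.
have touch (i : 'I_n.+1) : F (i, true) `&` F (i, false) !=set0.
  exists (v + i%:R *: d); split; [exists w => //|exists v => //=].
    by rewrite /= addrC subrK.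
  by rewrite scale1r.
have core (i j : 'I_n.+1) : F (i, false) `&` F (j, false) !=set0.
  have [|y [z [Py Pz yz]]] := Ph ((j%:R - i%:R) *: d).
    rewrite l1Z -ld ltr_pM2r // ltr_norml.
    have iN : i%:R < N by rewrite ltr_nat.
    have jN : j%:R < N by rewrite ltr_nat.
    have i0 : 0 <= i%:R :> R by rewrite ler0n.
    have j0 : 0 <= j%:R :> R by rewrite ler0n.
    by apply/andP; split; lra.
  exists (y + i%:R *: d); split; [exists y => //=|exists z => //=].
    by rewrite scale1r.
  have -> : y = (j%:R - i%:R) *: d + z by rewrite -yz subrK.
  by rewrite scale1r scalerBl addrAC subrK addrC.
move=> [i b] [j c]; rewrite xpair_eqE /= /corona_adj /=.
have [<-|ij] := eqVneq i j.
  case: b c => -[] //= _; split=> // _; last rewrite setIC; exact: touch.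
case: b c => -[] //= _; split=> //.
- move=> [_ [[y Py <-] [z Pz E]]]; rewrite (apart i j y z) ?eqxx // in ij.
  by apply/rowP => m; have /= := congr1 (fun x : plane => x 0 m) E;
    rewrite !mxE; lra.
- by move/cross_disjoint => E; rewrite E eqxx in ij.
- by rewrite setIC => /cross_disjoint E; rewrite E eqxx in ij.
Qed.

End Plane.

Theorem lemma3 (R : realType) (P : set 'rV[R]_2) (k : nat)
    (hP : polygon P) (hk : 2 <= k) :
  ~ subclass (DIR R k) (Phom P) /\ ~ subclass (Phom P) (DIR R k).
Proof.
split=> [H|H].
  by have [n []] := Phom_bounded_bipartite hP; apply/H/DIR_biclique.
exact/(@not_DIR_corona R k)/H/Phom_corona.
Qed.
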